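(* Let $a<b$ be real numbers and let $A=\{(x,y)\in \mathbb{R}/\mathbb{Z}\times\mathbb{R} \mid a\le y\le b\}$. Let $n\ge 1$ and let $B_n$ be the braid group on $n$ strands. For every braid $\beta\in B_n$ there exist a Hamiltonian function $H_\beta=H_\beta(t,x,y)\in C^\infty(\mathbb{R}/\mathbb{Z}\times A)$ and $n$ points $a_1,\dots,a_n$ in the planar strip $\mathbb{R}\times[a,b]$ such that the set $$\bigl\{\{\varphi_t(a_1),\dots,\varphi_t(a_n)\}\times\{t\} \;\big|\; t\in[0,1]\bigr\}$$ is a geometric braid representing $\beta$, where $\varphi_t$ denotes the Hamiltonian flow of $H_\beta$ (starting at time $0$), lifted to $\mathbb{R}\times[a,b]$; in particular the trajectories $\varphi_t(a_i)$ are defined for all $t\in[0,1]$.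
   Context: A function $H\in C^\infty(\mathbb{R}/\mathbb{Z}\times A)$ is regarded as a smooth function $H(t,x,y)$ on $\mathbb{R}\times\mathbb{R}\times[a,b]$ which is $1$-periodic in $t$ and in $x$. Its Hamiltonian flow $\varphi_t$ sends an initial value $(x_0,y_0)$ to the value $(x(t),y(t))$ at time $t$ of the solution of $\dot x=H_y(t,x,y)$, $\dot y=-H_x(t,x,y)$ with $(x(0),y(0))=(x_0,y_0)$; solutions are considered in the strip $\mathbb{R}\times[a,b]\subset\mathbb{R}^2$. The braid group is $$B_n=\langle \sigma_1,\dots,\sigma_{n-1}\mid \sigma_i\sigma_j=\sigma_j\sigma_i \text{ if } |i-j|>1,\ \sigma_i\sigma_j\sigma_i=\sigma_j\sigma_i\sigma_j \text{ if } |i-j|=1\rangle .$$ A geometric braid on $n$ strands is a set $\{\{p_1(t),\dots,p_n(t)\}\times\{t\}\mid t\in[0,1]\}\subset\mathbb{R}^2\times[0,1]$, where $p_1,\dots,p_n:[0,1]\to\mathbb{R}^2$ are continuous, the points $p_1(t),\dots,p_n(t)$ are pairwise distinct for each $t$, and $\{p_1(1),\dots,p_n(1)\}=\{p_1(0),\dots,p_n(0)\}$. The base points $p_i(0)$ lie on a horizontal line, ordered by increasing $x$-coordinate. Geometric braids with given base points, up to homotopy through geometric braids with those base points, are identified with elements of $B_n$ in the usual way: $\sigma_i$ is the class of the braid in which the $i$-th and $(i+1)$-st points are exchanged by a half-turn (in a fixed sense, say clockwise) in a small neighbourhood of the segment joining them while the other points stay fixed, $\sigma_i^{-1}$ is the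 half-turn in the opposite sense, and the product is concatenation in time. *)

(* Defs.v *)
From HB Require Import structures.
From mathcomp Require Import all_boot all_order all_algebra all_fingroup.
From mathcomp Require Import generic_quotient.
From mathcomp Require Import all_classical all_reals all_analysis.

Set Implicit Arguments.
Unset Strict Implicit.
Unset Printing Implicit Defensive.

Import Order.TTheory GRing.Theory Num.Theory.
Import numFieldNormedType.Exports.

Local Open Scope classical_set_scope.
Local Open Scope quotient_scope.
Local Open Scope ring_scope.

Section BraidGroup.
Variable n : nat.

(* The letter (i, true) stands for the generator exchanging the strands i and
   i + 1 (counted from 0), and (i, false) for its inverse. *)
Definition braid_word := seq ('I_n.-1 * bool).

Inductive braid_relator : braid_word -> braid_word -> Prop :=
| braid_cancel i e : braid_relator [:: (i, e); (i, ~~ e)] [::]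
| braid_far (i j : 'I_n.-1) : (1 < `|i - j|)%N ->
    braid_relator [:: (i, true); (j, true)] [:: (j, true); (i, true)]
| braid_near (i j : 'I_n.-1) : (`|i - j| = 1)%N ->
    braid_relator [:: (i, true); (j, true); (i, true)]
                  [:: (j, true); (i, true); (j, true)].

Inductive braid_equiv : braid_word -> braid_word -> Prop :=
| braid_equiv_step u v r s : braid_relator r s ->
    braid_equiv (u ++ r ++ v) (u ++ s ++ v)
| braid_equiv_refl u : braid_equiv u u
| braid_equiv_sym u v : braid_equiv u v -> braid_equiv v u
| braid_equiv_trans u v w :
    braid_equiv u v -> braid_equiv v w -> braid_equiv u w.

Definition braid_equivb (u v : braid_word) : bool := `[< braid_equiv u v >].

Lemma braid_equivb_refl : reflexive braid_equivb.
Proof. by move=> u; apply/asboolP; exact: braid_equiv_refl. Qed.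

Lemma braid_equivb_sym : symmetric braid_equivb.
Proof. by move=> u v; apply/asboolP/asboolP; exact: braid_equiv_sym. Qed.

Lemma braid_equivb_trans : transitive braid_equivb.
Proof.
move=> v u w /asboolP uv /asboolP vw.
by apply/asboolP; exact: braid_equiv_trans uv vw.
Qed.

Canonical braid_equiv_rel :=
  EquivRel braid_equivb braid_equivb_refl braid_equivb_sym braid_equivb_trans.

Definition braid_group := {eq_quot braid_equiv_rel}.
HB.instance Definition _ := Choice.on braid_group.

Definition braid_class (w : braid_word) : braid_group :=
  (\pi_({eq_quot braid_equiv_rel}) w)%qT.

Lemma braid_classP (u v : braid_word) :
  braid_class u = braid_class v <-> braid_equiv u v.
Proof.
by rewrite /braid_class; split=> [/eqmodP/asboolP|uv]//; apply/eqmodP/asboolP.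
Qed.

Lemma braid_class_repr (x : braid_group) : braid_class (repr x) = x.
Proof. exact: reprK. Qed.

Definition inv_word (w : braid_word) : braid_word :=
  rev [seq (l.1, ~~ l.2) | l <- w].

Lemma braid_equiv_ctx (x y u v : braid_word) :
  braid_equiv u v -> braid_equiv (x ++ u ++ y) (x ++ v ++ y).
Proof.
elim=> {u v} [u v r s rs|u|u v _|u v w _ uv _ vw].
- by have := braid_equiv_step (x ++ u) (v ++ y) rs; rewrite !catA.
- exact: braid_equiv_refl.
- exact: braid_equiv_sym.
- exact: braid_equiv_trans uv vw.
Qed.

Lemma braid_equiv_cat (u u' v v' : braid_word) :
  braid_equiv u u' -> braid_equiv v v' -> braid_equiv (u ++ v) (u' ++ v').
Proof.
move=> uu' vv'; apply: (@braid_equiv_trans _ (u' ++ v)).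
  exact: (braid_equiv_ctx [::] v uu').
by have := braid_equiv_ctx u' [::] vv'; rewrite !cats0.
Qed.

Lemma inv_word_cat (u v : braid_word) :
  inv_word (u ++ v) = inv_word v ++ inv_word u.
Proof. by rewrite /inv_word map_cat rev_cat. Qed.

Lemma inv_wordK : involutive inv_word.
Proof.
move=> w; rewrite /inv_word map_rev revK -map_comp -[RHS]map_id.
by apply: eq_map => -[i e]; rewrite /= negbK.
Qed.

Lemma braid_equiv_mulV (w : braid_word) : braid_equiv (w ++ inv_word w) [::].
Proof.
elim: w => [|[i e] w IHw]; first exact: braid_equiv_refl.
rewrite -cat1s inv_word_cat.
apply: (@braid_equiv_trans _ ([:: (i, e)] ++ [:: (i, ~~ e)])).
  have := braid_equiv_ctx [:: (i, e)] [:: (i, ~~ e)] IHw.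
  by rewrite !catA.
exact: (braid_equiv_step [::] [::] (braid_cancel i e)).
Qed.

Lemma braid_equiv_inv (u v : braid_word) :
  braid_equiv u v -> braid_equiv (inv_word u) (inv_word v).
Proof.
move=> uv; apply: (@braid_equiv_trans _ (inv_word u ++ (v ++ inv_word v))).
  rewrite -[X in braid_equiv X _]cats0.
  apply: braid_equiv_cat; first exact: braid_equiv_refl.
  exact/braid_equiv_sym/braid_equiv_mulV.
rewrite catA -[X in braid_equiv _ X]cat0s.
apply: braid_equiv_cat; last exact: braid_equiv_refl.
apply: (@braid_equiv_trans _ (inv_word u ++ u)).
  apply: braid_equiv_cat; first exact: braid_equiv_refl.
  exact: braid_equiv_sym.
by have := braid_equiv_mulV (inv_word u); rewrite inv_wordK.
Qed.

Definition braid_one : braid_group := braid_class [::].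
Definition braid_mul (x y : braid_group) : braid_group :=
  braid_class (repr x ++ repr y).
Definition braid_inv (x : braid_group) : braid_group :=
  braid_class (inv_word (repr x)).

Lemma braid_mulE (u v : braid_word) :
  braid_mul (braid_class u) (braid_class v) = braid_class (u ++ v).
Proof.
by apply/braid_classP/braid_equiv_cat; apply/braid_classP/braid_class_repr.
Qed.

Lemma braid_invE (u : braid_word) :
  braid_inv (braid_class u) = braid_class (inv_word u).
Proof. exact/braid_classP/braid_equiv_inv/braid_classP/braid_class_repr. Qed.

Lemma braid_mulA : associative braid_mul.
Proof.
move=> x y z; rewrite -(braid_class_repr x) -(braid_class_repr y).
by rewrite -(braid_class_repr z) !braid_mulE catA.
Qed.

Lemma braid_mul1 : left_id braid_one braid_mul.
Proof. by move=> x; rewrite -(braid_class_repr x) braid_mulE. Qed.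

Lemma braid_mulr1 : right_id braid_one braid_mul.
Proof. by move=> x; rewrite -(braid_class_repr x) braid_mulE cats0. Qed.

Lemma braid_mulV : left_inverse braid_one braid_inv braid_mul.
Proof.
move=> x; rewrite -(braid_class_repr x) braid_invE braid_mulE.
apply/braid_classP.
by have := braid_equiv_mulV (inv_word (repr x)); rewrite inv_wordK.
Qed.

Lemma braid_mulrV : right_inverse braid_one braid_inv braid_mul.
Proof.
move=> x; rewrite -(braid_class_repr x) braid_invE braid_mulE.
exact/braid_classP/braid_equiv_mulV.
Qed.

HB.instance Definition _ := isGroup.Build braid_group
  braid_mulA braid_mul1 braid_mulr1 braid_mulV braid_mulrV.

Definition sigma (i : 'I_n.-1) : braid_group := braid_class [:: (i, true)].

Definition letter_eval (l : 'I_n.-1 * bool) : braid_group :=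
  if l.2 then sigma l.1 else (sigma l.1)^-1%g.

Definition word_eval (w : braid_word) : braid_group :=
  (\prod_(l <- w) letter_eval l)%g.

Lemma word_evalE (w : braid_word) : word_eval w = braid_class w.
Proof.
rewrite /word_eval; elim: w => [|l w IHw]; first by rewrite big_nil.
have -> : braid_class (l :: w) = (braid_class [:: l] * braid_class w)%g.
  exact/esym/braid_mulE.
rewrite big_cons IHw; congr (_ * _)%g.
by case: l => i [] //; exact: braid_invE.
Qed.

End BraidGroup.

Section GeometricBraids.
Variables (R : realType) (n : nat).
Local Notation plane := (R * R)%type.
(* Only the values of a strand at times in [0, 1] are relevant. *)
Local Notation strands := ('I_n -> R -> plane).

Definition aligned (c : 'I_n -> plane) : Prop :=
  (forall i j, (c i).2 = (c j).2) /\
  (forall i j : 'I_n, (i < j)%N -> (c i).1 < (c j).1).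

Definition geometric_braid (p : strands) : Prop :=
  [/\ forall i, {within `[0, 1], continuous (p i)},
      forall t : R, t \in `[0, 1] -> injective (fun i => p i t),
      range (fun i => p i 1) = range (fun i => p i 0)
    & aligned (fun i => p i 0)].

Definition braid_homotopic (p q : strands) : Prop :=
  exists F : R -> strands,
    [/\ forall i, {within `[0, 1] `*` `[0, 1],
          continuous (fun st : R * R => F st.1 i st.2)},
        forall s : R, s \in `[0, 1] -> geometric_braid (F s),
        forall (s : R) i, s \in `[0, 1] -> F s i 0 = p i 0
      & forall i (t : R), t \in `[0, 1] -> F 0 i t = p i t /\ F 1 i t = q i t].

Lemma next_strand_subproof (i : 'I_n.-1) : (i.+1 < n)%N.
Proof. by rewrite -ltn_predRL. Qed.

Definition exchange (i : 'I_n.-1) : {perm 'I_n} :=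
  tperm (widen_ord (leq_pred n) i) (Ordinal (next_strand_subproof i)).

Definition rotate_about (m z : plane) (theta : R) : plane :=
  (m.1 + (cos theta * (z.1 - m.1) - sin theta * (z.2 - m.2)),
   m.2 + (sin theta * (z.1 - m.1) + cos theta * (z.2 - m.2))).

Definition midpoint (z w : plane) : plane :=
  ((z.1 + w.1) / 2, (z.2 + w.2) / 2).

(* Positive generators turn clockwise.  A strand that is not exchanged is its
   own partner, hence rotates about itself, i.e. stays fixed. *)
Definition half_turn (c : 'I_n -> plane) (l : 'I_n.-1 * bool) : strands :=
  fun i t => rotate_about (midpoint (c i) (c (exchange l.1 i))) (c i)
               (if l.2 then - (pi * t) else pi * t).

(* The half-turn given by the first letter fills the first half of the time
   interval; the strand starting at c i then continues from c (exchange l.1 i). *)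
Fixpoint word_braid (c : 'I_n -> plane) (w : braid_word n) : strands :=
  match w with
  | [::] => fun i _ => c i
  | l :: w' => fun i t =>
      if t <= 2^-1 then half_turn c l i (2 * t)
      else word_braid c w' (exchange l.1 i) (2 * t - 1)
  end.

Definition represents (p : strands) (beta : braid_group n) : Prop :=
  geometric_braid p /\
  exists2 w : braid_word n, word_eval w = beta
    & braid_homotopic (word_braid (fun i => p i 0) w) p.

End GeometricBraids.

Section Hamiltonians.
Variable R : realType.
(* A point (t, x, y) of the extended phase space. *)
Local Notation space := (R * R * R)%type.

Definition dir_t : space := (1, 0, 0).
Definition dir_x : space := (0, 1, 0).
Definition dir_y : space := (0, 0, 1).

Definition iter_partial (s : seq space) (H : space -> R) : space -> R :=
  foldr (fun v g p => 'D_v g p) H s.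

Definition smooth_on_open (U : set space) (H : space -> R) : Prop :=
  forall s : seq space, {subset s <= [:: dir_t; dir_x; dir_y]} ->
  forall p, U p ->
    {for p, continuous (iter_partial s H)} /\
    forall v, v \in [:: dir_t; dir_x; dir_y] ->
      derivable (iter_partial s H) p v.

(* Smoothness on an arbitrary set D: smoothness on a neighbourhood of D.  Only
   the values near D matter, the others are arbitrary. *)
Definition smooth_on (D : set space) (H : space -> R) : Prop :=
  exists U : set space, [/\ open U, D `<=` U & smooth_on_open U H].

Definition strip (a b : R) : set (R * R) := [set z | a <= z.2 <= b].

Definition extended_strip (a b : R) : set space :=
  [set p | a <= p.2 <= b].

Definition annulus_hamiltonian (a b : R) (H : space -> R) : Prop :=
  smooth_on (extended_strip a b) H /\
  forall t x y, a <= y <= b ->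
    H (t + 1, x, y) = H (t, x, y) /\ H (t, x + 1, y) = H (t, x, y).

(* z is the solution on [0, 1], within the strip, of the Hamiltonian equations
   with initial value z0; z t is the image of z0 under the time-t flow. *)
Definition flow_trajectory (a b : R) (H : space -> R) (z0 : R * R)
    (z : R -> R * R) : Prop :=
  [/\ z 0 = z0,
      forall t : R, t \in `[0, 1] -> strip a b (z t),
      {within `[0, 1], continuous z}
    & forall t : R, t \in `]0, 1[ ->
        is_derive t 1 (fun s => (z s).1) ('D_dir_y H (t, (z t).1, (z t).2)) /\
        is_derive t 1 (fun s => (z s).2) (- 'D_dir_x H (t, (z t).1, (z t).2))].

End Hamiltonians.

(* Main.v *)
Require Import Defs.
From mathcomp Require Import all_boot all_order all_algebra all_fingroup.
From mathcomp Require Import all_classical all_reals all_analysis.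
From mathcomp Require Import ring lra.
Import Order.TTheory GRing.Theory Num.Theory.
Import numFieldNormedType.Exports.
Local Open Scope classical_set_scope.
Local Open Scope ring_scope.

(* No flow theory is needed: the trajectories are explicit.  All base points
   (x_j, ym) lie on one horizontal line.  A half-turn is deformed into three
   shears: a vertical one lifts one strand and lowers the other, a horizontal
   one (with Hamiltonian proportional to (y - ym)^2) swaps their abscissae, and
   a vertical one brings both back.  The vertical shears have Hamiltonians
   depending on x only; trigonometric interpolation makes them 1-periodic with
   prescribed slopes at the x_j.  Each shear is switched on by the derivative of
   a smooth step, so that the letters of a word can be concatenated in time and
   the result extended periodically.  The straight-line homotopy from the
   half-turns to the shears is a homotopy of braids: two strands at the same
   height at the same time are displaced by the same amount. *)

Set Implicit Arguments.
Unset Strict Implicit.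

(** * Smooth functions of one real variable *)

Section Calculus.
Context {R : realType}.
Implicit Types (f g df dg : R -> R) (x a b : R) (m : nat).

Lemma is_derive_unique f x a b :
  is_derive x 1 f a -> is_derive x 1 f b -> a = b.
Proof. by move=> [_ <-] [_ <-]. Qed.

Lemma is_derive_addf f g x a b : is_derive x 1 f a -> is_derive x 1 g b ->
  is_derive x 1 (fun y => f y + g y) (a + b).
Proof. by move=> fa gb; exact: is_deriveD. Qed.

Lemma is_derive_mulf f g x a b : is_derive x 1 f a -> is_derive x 1 g b ->
  is_derive x 1 (fun y => f y * g y) (a * g x + f x * b).
Proof.
move=> fa gb; apply: (is_derive_eq (is_deriveM fa gb)).
by rewrite /GRing.scale /=; ring.
Qed.

Lemma is_derive_compf f g x a b : is_derive (g x) 1 f a -> is_derive x 1 g b ->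
  is_derive x 1 (fun y => f (g y)) (a * b).
Proof. by move=> fa gb; exact: (is_derive1_comp fa gb). Qed.

Lemma is_derive_affine x a b : is_derive x 1 (fun y => a * y + b) a.
Proof.
rewrite -[X in is_derive _ _ _ X](_ : 0 * x + a * 1 + 0 = a); last by ring.
by apply: is_derive_addf; apply: is_derive_mulf.
Qed.

Lemma is_derive_continuous f df :
  (forall x, is_derive x 1 f (df x)) -> continuous f.
Proof.
move=> fdf x; apply: differentiable_continuous.
by apply/derivable1_diffP; exact: ex_derive.
Qed.

(** Continuity of the last derivative is not demanded; once [m] ranges over all naturals this makes
    no difference. *)
Fixpoint Cn m f : Prop :=
  if m is m'.+1 then exists2 df, forall x, is_derive x 1 f (df x) & Cn m' df
  else True.

Definition smooth f := forall m, Cn m f.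

(** Derivatives are unique, so the witnesses obtained at all orders are one and the same
    function. *)
Lemma smoothE f : smooth f ->
  exists2 df, forall x, is_derive x 1 f (df x) & smooth df.
Proof.
move=> sf; have [df fdf _] := sf 1%N; exists df => // m.
have [df' fdf'] := sf m.+1.
suff -> : df = df' by [].
by apply/funext => x; exact: is_derive_unique (fdf x) (fdf' x).
Qed.

Lemma Cn_pred m f : Cn m.+1 f -> Cn m f.
Proof.
elim: m f => [//|m IH] f [df fdf Cdf].
by exists df => //; exact: IH.
Qed.

(** A coinduction principle, meant for classes closed under differentiation such as the combinations
    of sine and cosine. *)
Lemma smooth_coind (S : (R -> R) -> Prop) :
  (forall f, S f -> exists2 df, forall x, is_derive x 1 f (df x) & S df) ->
  forall f, S f -> smooth f.
Proof.
move=> HS f Sf m; elim: m f Sf => [//|m IH] f /HS[df fdf Sdf].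
by exists df => //; exact: IH.
Qed.

Lemma smooth_cst a : smooth (fun=> a).
Proof.
apply: (@smooth_coind (fun f => exists a, f = fun=> a)); last by exists a.
by move=> _ [b ->]; exists (fun=> 0); [move=> x; exact: is_derive_cst|exists 0].
Qed.

Lemma Cn_add m f g : Cn m f -> Cn m g -> Cn m (fun x => f x + g x).
Proof.
elim: m f g => [//|m IH] f g [df fdf Cf] [dg gdg Cg].
by exists (fun x => df x + dg x); [move=> x; exact: is_derive_addf|exact: IH].
Qed.

Lemma Cn_mul m f g : Cn m f -> Cn m g -> Cn m (fun x => f x * g x).
Proof.
elim: m f g => [//|m IH] f g Cf Cg.
have [df fdf Cdf] := Cf; have [dg gdg Cdg] := Cg.
exists (fun x => df x * g x + f x * dg x); first by move=> x; exact: is_derive_mulf.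
by apply: Cn_add; apply: IH => //; exact: Cn_pred.
Qed.

Lemma Cn_comp m f g : Cn m f -> Cn m g -> Cn m (fun x => f (g x)).
Proof.
elim: m f g => [//|m IH] f g Cf Cg.
have [df fdf Cdf] := Cf; have [dg gdg Cdg] := Cg.
exists (fun x => df (g x) * dg x); first by move=> x; exact: is_derive_compf.
by apply: Cn_mul => //; apply: IH => //; exact: Cn_pred.
Qed.

Lemma smooth_add f g : smooth f -> smooth g -> smooth (fun x => f x + g x).
Proof. by move=> sf sg m; exact: Cn_add. Qed.

Lemma smooth_mul f g : smooth f -> smooth g -> smooth (fun x => f x * g x).
Proof. by move=> sf sg m; exact: Cn_mul. Qed.

Lemma smooth_comp f g : smooth f -> smooth g -> smooth (fun x => f (g x)).
Proof. by move=> sf sg m; exact: Cn_comp. Qed.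

Lemma smooth_affine a b : smooth (fun x => a * x + b).
Proof.
case=> [//|m]; exists (fun=> a); first by move=> x; exact: is_derive_affine.
exact: smooth_cst.
Qed.

Lemma smooth_sin : smooth sin.
Proof.
apply: (@smooth_coind (fun f => exists a b, f = fun x => a * sin x + b * cos x)).
  move=> _ [a [b ->]]; exists (fun x => (- b) * sin x + a * cos x);
    last by exists (- b), a.
  move=> x; rewrite -[X in is_derive _ _ _ X](_ :
    (0 * sin x + a * cos x) + (0 * cos x + b * - sin x) = _); last by ring.
  by apply: is_derive_addf; apply: is_derive_mulf.
by exists 1, 0; apply/funext => x; rewrite mul1r mul0r addr0.
Qed.

Lemma smooth_prod (I : finType) (P : pred I) (F : I -> R -> R) :
  (forall i, smooth (F i)) -> smooth (fun x => \prod_(i | P i) F i x).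
Proof.
move=> sF; elim: (index_enum I) => [|i r IH].
  have -> : (fun x => \prod_(i <- [::] | P i) F i x) = fun=> 1.
    by apply/funext => x; rewrite big_nil.
  exact: smooth_cst.
have -> : (fun x => \prod_(j <- i :: r | P j) F j x) =
    fun x => (if P i then F i else fun=> 1) x * \prod_(j <- r | P j) F j x.
  by apply/funext => x; rewrite big_cons; case: (P i); rewrite ?mul1r.
by apply: smooth_mul => //; case: (P i) => //; exact: smooth_cst.
Qed.

Lemma is_derive_near_eq f g x a : (\near x, f x = g x) ->
  is_derive x 1 f a -> is_derive x 1 g a.
Proof. by move=> fg; apply: near_eq_is_derive; apply: filterS fg => y ->. Qed.

Lemma is_derive_near_cst f x a : (\near x, f x = a) -> is_derive x 1 f 0.
Proof.
move=> fa.
have af : \near x, (fun=> a) x = f x by apply: filterS fa => y ->.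
by apply: (is_derive_near_eq af).
Qed.

(** The difference quotient at [0] is bounded by [C * |h|]. This settles the gluing point of the
    flat functions. *)
Lemma is_derive_quadratic f C : f 0 = 0 -> (forall x, `|f x| <= C * x ^+ 2) ->
  is_derive (0 : R) 1 f 0.
Proof.
move=> f0 fC.
have fc : h^-1 *: (f (h *: 1 + 0) - f 0) @[h --> 0^'] --> (0 : R).
  apply/cvgr0Pnorm_le => e e0 /=.
  have C0 : 0 <= C by have := le_trans (normr_ge0 _) (fC 1); rewrite expr1n mulr1.
  near=> h.
  have h0 : h != 0 by near: h; exact: nbhs_dnbhs_neq.
  rewrite f0 subr0 addr0 /GRing.scale /= mulr1 normrM normfV.
  rewrite ler_pdivrMl ?normr_gt0// (le_trans (fC h))//.
  rewrite -normr_id -(real_normK (num_real h)) normr_id expr2 mulrCA ler_wpM2l//.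
  (* Dividing by [C + 1] rather than [C] covers the case [C = 0]. *)
  have : `|h| <= e / (C + 1).
    near: h; apply: dnbhs0_le; rewrite divr_gt0// ltr_wpDl//.
  rewrite ler_pdivlMr ?ltr_wpDl// mulrDr mulr1 [C * _]mulrC.
  by apply: le_trans; rewrite lerDl.
apply: DeriveDef; first by apply/cvg_ex; exists 0.
by apply/cvg_lim.
Unshelve. all: by end_near. Qed.

End Calculus.

(** * Flat functions and a smooth step *)

Section Flat.
Context {R : realType}.
Implicit Types (f g df dg : R -> R) (x a b : R) (k m : nat).

(** The classical flat function is the case [k = 0]; the extra powers of [x^-1] make the span of the
    family closed under differentiation. *)
Definition flat k x : R := if 0 < x then x^-1 ^+ k * expR (- x^-1) else 0.

Lemma flat_le0 k x : x <= 0 -> flat k x = 0.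
Proof. by rewrite /flat ltNge => ->. Qed.

Lemma flat_ge0 k x : 0 <= flat k x.
Proof.
rewrite /flat; case: ltP => // x0.
by rewrite mulr_ge0 ?expR_ge0// exprn_ge0// invr_ge0 ltW.
Qed.

(** With [u = x^-1], the exponential [expR u] dominates its Taylor term of degree [k + 2], hence
    [u ^+ k * expR (- u)] is at most [(k + 2)!] times [x ^+ 2]. *)
Lemma flat_quadratic k x : `|flat k x| <= (k.+2)`!%:R * x ^+ 2.
Proof.
rewrite ger0_norm ?flat_ge0// /flat; case: ltP => x0; last first.
  by rewrite mulr_ge0 ?sqr_ge0.
set u := x^-1; have u0 : 0 < u by rewrite invr_gt0.
have fac0 : 0 < (k.+2)`!%:R :> R by rewrite ltr0n fact_gt0.
have := expR_ge1Dxn k.+1 (ltW u0).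
move=> /(le_trans (ler_wpDl ler01 (lexx _))).
rewrite ler_pdivrMr// => H.
have ux : u * x = 1 by rewrite mulVf ?gt_eqF.
rewrite expRN ler_pdivrMr ?expR_gt0//.
have -> : u ^+ k = u ^+ k.+2 * x ^+ 2.
  by rewrite -addn2 exprD -mulrA -exprMn ux expr1n mulr1.
by rewrite [leRHS]mulrAC ler_wpM2r ?sqr_ge0// mulrC.
Qed.

Lemma is_derive_exprn k x :
  is_derive x 1 (fun y : R => y ^+ k) (k%:R * x ^+ k.-1).
Proof.
apply: DeriveDef; first exact: exprn_derivable.
by rewrite exp_derive /GRing.scale /= mulr1.
Qed.

(** Away from [0] the function is locally zero or given by its formula; at [0] the quadratic bound
    yields the derivative [0]. *)
Lemma is_derive_flat k x :
  is_derive x 1 (flat k) (flat k.+2 x + - k%:R * flat k.+1 x).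
Proof.
have [x0|x0|->] := ltgtP x 0.
- rewrite !flat_le0 ?(ltW x0)// mulr0 addr0.
  apply: (@is_derive_near_cst _ _ _ 0).
  by near=> y; apply/flat_le0/ltW; near: y; exact: lt_nbhsl.
- have near_pos : \near x, x^-1 ^+ k * expR (- x^-1) = flat k x.
    near=> y; rewrite /flat ifT//.
    by near: y; exact: lt_nbhsr.
  apply: (is_derive_near_eq near_pos).
  have inv : is_derive x 1 (fun y : R => y^-1) (- x^-1 ^+ 2).
    rewrite -[X in is_derive _ _ _ X](_ : - x ^- 2 *: 1 = _); last first.
      by rewrite /GRing.scale /= mulr1 exprVn.
    by apply: is_deriveV; rewrite gt_eqF.
  rewrite /flat x0 -[X in is_derive _ _ _ X](_ :
    (k%:R * x^-1 ^+ k.-1 * - x^-1 ^+ 2) * expR (- x^-1) +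
    x^-1 ^+ k * (expR (- x^-1) * (-1 * - x^-1 ^+ 2)) = _).
    apply: is_derive_mulf.
    exact: (is_derive_compf (is_derive_exprn k x^-1) inv).
  by case: k near_pos => [|k] _ /=; rewrite ?mul0r ?exprS; ring.
- rewrite !flat_le0// mulr0 addr0.
  by apply: (is_derive_quadratic (flat_le0 _ _) (flat_quadratic k)).
Unshelve. all: by end_near. Qed.

Lemma smooth_flat k : smooth (flat k).
Proof.
move=> m; elim: m k => [//|m IH] k.
exists (fun x => flat k.+2 x + - k%:R * flat k.+1 x); first exact: is_derive_flat.
apply: Cn_add => //; apply: Cn_mul => //; exact: smooth_cst.
Qed.

(* Vanishes for x <= 0 and equals 1 for x >= 1, because expR 1 * flat 0 1 = 1:
   the nesting avoids the usual quotient. *)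
Definition step x : R := expR 1 * flat 0 (1 - expR 1 * flat 0 (1 - x)).

Lemma smooth_step : smooth step.
Proof.
have s1 c : smooth (fun x => expR 1 * flat 0 (1 - c * x)).
  apply: smooth_mul; first exact: smooth_cst.
  apply: smooth_comp (@smooth_flat 0) _.
  have -> : (fun x => 1 - c * x) = (fun x => - c * x + 1).
    by apply/funext => x; ring.
  exact: smooth_affine.
have -> : step = fun x => (fun y => expR 1 * flat 0 (1 - 1 * y))
    ((fun y => expR 1 * flat 0 (1 - 1 * y)) x).
  by apply/funext => x; rewrite /step !mul1r.
exact: (smooth_comp (s1 1) (s1 1)).
Qed.

Lemma flat0_le x y : x <= y -> flat 0 x <= flat 0 y.
Proof.
rewrite /flat !expr0 !mul1r => xy; case: (ltP 0 x) => x0; last first.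
  by case: ifP => // _; exact: expR_ge0.
by rewrite (lt_le_trans x0 xy) ler_expR lerN2 lef_pV2 // posrE (lt_le_trans x0).
Qed.

Lemma expR1_flat1 : expR 1 * flat 0 1 = 1.
Proof. by rewrite /flat ltr01 expr0 mul1r invr1 expRN divff ?gt_eqF ?expR_gt0. Qed.

Lemma step_le0 x : x <= 0 -> step x = 0.
Proof.
move=> x0; rewrite /step [X in _ * X]flat_le0 ?mulr0// subr_le0 -[leLHS]expR1_flat1.
by rewrite ler_wpM2l ?expR_ge0// flat0_le// lerBrDr gerDl.
Qed.

Lemma step_ge1 x : 1 <= x -> step x = 1.
Proof.
move=> x1; rewrite /step [flat 0 (1 - x)]flat_le0 ?subr_le0// mulr0 subr0.
exact: expR1_flat1.
Qed.

Lemma step_ge0 x : 0 <= step x.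
Proof. by rewrite mulr_ge0 ?expR_ge0 ?flat_ge0. Qed.

Lemma step_le1 x : step x <= 1.
Proof.
rewrite -[leRHS]expR1_flat1 ler_wpM2l ?expR_ge0// flat0_le//.
by rewrite lerBlDr lerDl mulr_ge0 ?expR_ge0 ?flat_ge0.
Qed.

End Flat.

(** * Periodic extension of functions supported inside the unit interval *)

Section Periodization.
Context {R : realType}.
Implicit Types (f g df dg : R -> R) (x a b : R) (k m : nat).

(** The margin [d] keeps the support away from both ends, and vanishing on open sets passes to
    derivatives. *)
Definition supported f := exists2 d, 0 < d & forall t, t < d \/ 1 - d < t -> f t = 0.

Lemma supported_le0 f t : supported f -> t <= 0 -> f t = 0.
Proof. by move=> [d d0 H] t0; apply: H; left; exact: le_lt_trans d0. Qed.

Lemma supported_ge1 f t : supported f -> 1 <= t -> f t = 0.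
Proof. by move=> [d d0 H] t0; apply: H; right; rewrite (lt_le_trans _ t0)// gtrBl. Qed.

Lemma supported_derive f df :
  (forall t : R, is_derive t 1 f (df t)) -> supported f -> supported df.
Proof.
move=> fdf [d d0 H]; exists d => // t ht.
apply: (is_derive_unique (fdf t)); apply: (@is_derive_near_cst _ _ _ 0).
case: ht => ht; near=> y; apply: H.
  by left; near: y; exact: lt_nbhsl.
by right; near: y; exact: lt_nbhsr.
Unshelve. all: by end_near. Qed.

Definition periodize f (t : R) : R := f (t - (Num.floor t)%:~R).

Lemma periodize_period f t : periodize f (t + 1) = periodize f t.
Proof.
rewrite /periodize floorDrz ?int_num1// floor1 intrD opprD addrACA subrr.
by rewrite addr0.
Qed.

Lemma periodize_id f t : 0 < t < 1 -> periodize f t = f t.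
Proof.
move=> /andP[t0 t1]; rewrite /periodize.
have /eqP -> : Num.floor t == 0 by rewrite floor_eq ?add0r (ltW t0) t1.
by rewrite subr0.
Qed.

(** On this window around the integer [m] only two translates of [f] can be nonzero, so the
    discontinuous floor disappears from the formula. *)
Lemma periodize_local f (m : int) t : supported f ->
  m%:~R - 1 < t < m%:~R + 1 ->
  periodize f t = f (t - m%:~R) + f (t - (m%:~R - 1)).
Proof.
move=> sf /andP[m1 m2]; rewrite /periodize.
have [mt|tm] := leP m%:~R t.
  have -> : Num.floor t = m by apply/eqP; rewrite floor_eq mt intrD m2.
  rewrite (@supported_ge1 f (t - (m%:~R - 1)) sf) ?addr0//; lra.
have -> : Num.floor t = m - 1.
  apply/eqP; rewrite floor_eq subrK tm andbT intrB; lra.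
rewrite intrB (@supported_le0 f (t - m%:~R) sf) ?add0r//; lra.
Qed.

(** The derivative of a periodized function is the periodized derivative, so coinduction applies to
    the class of periodized smooth supported functions. *)
Lemma smooth_periodize f : smooth f -> supported f -> smooth (periodize f).
Proof.
move=> smf spf; apply: (@smooth_coind _ (fun g => exists f, [/\ g = periodize f, smooth f
  & supported f])); last by exists f.
move=> _ {f smf spf} [f [-> smf sf]]; have [df fdf smdf] := smoothE smf.
have sdf := supported_derive fdf sf.
exists (periodize df); last by exists df.
(* With this [m], the point [x] is interior to the window from [m - 1] to [m + 1], even when [x] is
   an integer. *)
move=> x; set m := Num.floor x.
have mx : m%:~R <= x by rewrite floor_le.
have xm : x < m%:~R + 1 by have := floorD1_gt x; rewrite intrD.
have near_per : \near x, f (1 * x + - m%:~R) + f (1 * x + - (m%:~R - 1)) = periodize f x.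
  near=> y; rewrite !mul1r (@periodize_local _ m)//; apply/andP; split.
    by near: y; apply: lt_nbhsr; lra.
  by near: y; exact: lt_nbhsl.
rewrite (@periodize_local _ m)//; last by apply/andP; split; lra.
apply: (is_derive_near_eq near_per); apply: is_derive_addf.
  rewrite -[X in is_derive _ _ _ X]mulr1 -{2}[x]mul1r.
  by apply: is_derive_compf; exact: is_derive_affine.
rewrite -[X in is_derive _ _ _ X]mulr1 -{2}[x]mul1r.
by apply: is_derive_compf; exact: is_derive_affine.
Unshelve. all: by end_near. Qed.

End Periodization.

(** * Trigonometric interpolation of slopes *)

Section Interpolation.
Context {R : realType}.
Implicit Types (y : R).

Lemma is_derive_sumf n (f : 'I_n -> R -> R) (df : 'I_n -> R) (y : R) :
  (forall i, is_derive y 1 (f i) (df i)) ->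
  is_derive y 1 (fun z => \sum_i f i z) (\sum_i df i).
Proof.
move=> fdf; rewrite -[X in is_derive _ _ X](_ : \sum_i f i = _).
  exact: is_derive_sum.
by apply/funext => z; rewrite fct_sumE.
Qed.

(** [E j] is a multiple of [sin (2 pi (y - x j))] times the squares of [sin (pi (y - x k))] for
    [k != j]: a simple zero at [x j], double zeros at the other nodes. Squaring makes these factors
    1-periodic, and the bounds on the distances keep them nonzero at [x j]. *)
Lemma trig_interpolation n (x : 'I_n -> R) :
  (forall i j, i != j -> 0 < `|x i - x j| < 1) ->
  exists (E dE : 'I_n -> R -> R),
    [/\ forall j, smooth (E j), forall j y, E j (y + 1) = E j y,
        forall j y, is_derive y 1 (E j) (dE j y)
      & forall j k, dE j (x k) = (j == k)%:R].
Proof.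
move=> hx.
pose w k y : R := sin (pi * y + - (pi * x k)).
pose v j y := \prod_(k | k != j) (w k y * w k y).
pose s j y : R := sin (2 * pi * y + - (2 * pi * x j)).
(* The slope of the unnormalised product at [x j]. *)
pose C j := 2 * pi * v j (x j).
pose E j y := (C j)^-1 * (s j y * v j y).
have sw k : smooth (w k) by apply: smooth_comp (@smooth_sin R) (smooth_affine _ _).
have ss k : smooth (s k) by apply: smooth_comp (@smooth_sin R) (smooth_affine _ _).
have sv j : smooth (v j) by apply: smooth_prod => k; exact: smooth_mul.
have sE j : smooth (E j) by apply: smooth_mul (smooth_cst _) (smooth_mul _ _).
have C0 j : C j != 0.
  rewrite mulf_neq0// ?mulf_neq0 ?pnatr_eq0 ?(gt_eqF (pi_gt0 _))//.
  apply/prodf_neq0 => k kj; rewrite -expr2 sqrf_eq0 /w -mulrN -mulrDr.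
  have /andP[h0 h1] := hx _ _ kj.
  have sgt z : 0 < z < 1 -> sin (pi * z) != 0 :> R.
    move=> /andP[z0 z1]; rewrite gt_eqF// sin_gt0_pi// mulr_gt0 ?pi_gt0//=.
    by rewrite gtr_pMr ?pi_gt0.
  case: (ltgtP (x k) (x j)) h0 h1 => [kj'|kj'|->]; last by rewrite subrr normr0 ltxx.
    by rewrite distrC gtr0_norm ?subr_gt0// => _ h1; apply: sgt; rewrite subr_gt0 kj'.
  rewrite gtr0_norm ?subr_gt0// => _ h1; rewrite -opprB mulrN sinN oppr_eq0.
  by apply: sgt; rewrite subr_gt0 kj'.
have dE j : exists dE, forall y, is_derive y 1 (E j) (dE y).
  by have [dE dEP _] := smoothE (sE j); exists dE.
have [dE_ dEP] := choice dE.
exists E, dE_; split => //.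
  move=> j y; rewrite /E; congr (_ * (_ * _)).
    rewrite /s mulrDr mulr1 addrAC [2 * pi in X in sin (_ + X)]mulrC mulr_natr.
    exact: sinD2pi.
  apply: eq_bigr => k _; rewrite /w mulrDr mulr1 addrAC sinDpi.
  by rewrite mulrNN.
move=> j k; apply: (is_derive_unique (dEP j (x k))).
case: eqVneq => [<-|jk] /=.
  have [dv dvP _] := smoothE (sv j).
  have := is_derive_mulf (is_derive_cst (C j)^-1 (x j) 1)
    (is_derive_mulf (is_derive_compf (is_derive_sin _)
      (is_derive_affine (x j) (2 * pi) (- (2 * pi * x j)))) (dvP (x j))).
  rewrite !subrr cos0 sin0 !mul0r mul1r add0r addr0 /cst.
  by rewrite mulVf.
(* One factor [w k] is split off; the cofactor still contains the other one, so both terms of the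
   product rule vanish at [x k]. *)
have [dr drP _] : exists2 dr, forall y, is_derive y 1 (fun y => w k y * (C j)^-1 * s j y *
    \prod_(i | (i != j) && (i != k)) (w i y * w i y)) (dr y) & smooth dr.
  apply: smoothE; apply: smooth_mul; first apply: smooth_mul => //.
    by apply: smooth_mul => //; exact: smooth_cst.
  by apply: smooth_prod => i; exact: smooth_mul.
have [dw dwP _] := smoothE (sw k).
have := is_derive_mulf (dwP (x k)) (drP (x k)).
have -> : w k (x k) = 0 by rewrite /w subrr sin0.
rewrite !mul0r mulr0 addr0.
congr (is_derive _ _ _ _); apply/funext => y.
rewrite /E /v [in RHS](bigD1 k) 1?eq_sym//=.
by ring.
Qed.

End Interpolation.

(** * Smoothness of sums of products with separated variables *)

Section SeparatedSums.
Context {R : realType}.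
Local Notation space := (R * R * R)%type.
Implicit Types (f g h : R -> R) (H K : space -> R) (p v : space).

(** Restriction to the line through [p] along [v] brings directional derivatives back to
    one-variable calculus. *)
Lemma is_derive_line H p v (d : R) :
  is_derive (0 : R) 1 (fun s : R => H (s *: v + p)) d -> is_derive p v H d.
Proof.
move=> [Hd <-]; split; first exact/derivable1P.
rewrite /derive; set g1 := fun z => z^-1 *: _; set g2 := fun z => z^-1 *: _.
suff -> : g1 = g2 by []; apply/funext => s; rewrite /g1 /g2 /=.
by rewrite addr0 scale0r add0r [s *: 1]mulr1.
Qed.

(** This class contains the Hamiltonians below and is closed under directional derivatives, which
    handles all iterated partials at once. *)
Inductive separated : (space -> R) -> Prop :=
| separated_mul f g h : smooth f -> smooth g -> smooth h ->
    separated (fun p => f p.1.1 * g p.1.2 * h p.2)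
| separated_add H K : separated H -> separated K ->
    separated (fun p => H p + K p).

Lemma separated_derive H v : separated H ->
  exists2 dH, forall p, is_derive p v H (dH p) & separated dH.
Proof.
elim=> {H} [f g h sf sg sh|H K _ [dH dHP sdH] _ [dK dKP sdK]]; last first.
  by exists (fun p => dH p + dK p); [move=> p; exact: is_deriveD|exact: separated_add].
have [df fP sdf] := smoothE sf; have [dg gP sdg] := smoothE sg.
have [dh hP sdh] := smoothE sh.
exists (fun p => v.1.1 * df p.1.1 * g p.1.2 * h p.2 +
  f p.1.1 * (v.1.2 * dg p.1.2) * h p.2 + f p.1.1 * g p.1.2 * (v.2 * dh p.2)).
  move=> p; apply: is_derive_line.
  have aux (k dk : R -> R) (c a : R) : (forall y : R, is_derive y 1 k (dk y)) ->
      is_derive (0 : R) 1 (fun s : R => k (c * s + a)) (c * dk a).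
    move=> kP; rewrite mulrC.
    apply: (@is_derive_compf _ k (fun s => c * s + a)); last exact: is_derive_affine.
    by rewrite mulr0 add0r.
  have := is_derive_mulf (is_derive_mulf (aux _ _ v.1.1 p.1.1 fP)
    (aux _ _ v.1.2 p.1.2 gP)) (aux _ _ v.2 p.2 hP).
  rewrite !mulr0 !add0r mulrDl.
  congr (is_derive _ _ _ _); apply/funext => s /=.
  by rewrite ![s *: _]mulrC.
have sc (c : R) k : smooth k -> smooth (fun x => c * k x).
  by move=> sk; apply: smooth_mul => //; exact: smooth_cst.
exact: (separated_add (separated_add (separated_mul (sc v.1.1 _ sdf) sg sh)
  (separated_mul sf (sc v.1.2 _ sdg) sh)) (separated_mul sf sg (sc v.2 _ sdh))).
Qed.

Lemma separated_continuous H : separated H -> continuous H.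
Proof.
elim=> {H} [f g h sf sg sh|H K _ cH _ cK] p; last by apply: cvgD; [exact: cH|exact: cK].
have cs k : smooth k -> continuous k.
  by move=> /smoothE[dk kP _]; exact: is_derive_continuous kP.
apply: cvgM; first apply: cvgM.
- by apply: (continuous_comp (continuous_comp _ _));
    [exact: cvg_fst|exact: cvg_fst|exact: cs].
- by apply: (continuous_comp (continuous_comp _ _));
    [exact: cvg_fst|exact: cvg_snd|exact: cs].
- by apply: continuous_comp; [exact: cvg_snd|exact: cs].
Qed.

(** Iterated partials stay separated, hence continuous and derivable in every direction; the whole
    space serves as the neighbourhood. *)
Lemma separated_smooth H (D : set space) : separated H -> smooth_on D H.
Proof.
move=> sH; exists setT; split=> //; first exact: openT.
move=> s _ p _.
have {sH}sep : separated (iter_partial s H).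
  elim: s => [//|v s IH] /=.
  have [dH dHP sdH] := separated_derive v IH.
  by rewrite (_ : (fun p => _) = dH)//; apply/funext => q; exact: derive_val.
split; first exact: separated_continuous.
move=> v _; have [dH dHP _] := separated_derive v sep.
exact: ex_derive.
Qed.

Lemma separated_sum n (F : 'I_n -> space -> R) :
  (forall i, separated (F i)) -> separated (fun p => \sum_i F i p).
Proof.
move=> sF; elim: (index_enum 'I_n) => [|i r IH].
  rewrite (_ : (fun p => _) = fun p => (fun=> 0) p.1.1 * (fun=> 0) p.1.2 * (fun=> 0) p.2).
    exact: (separated_mul (smooth_cst 0) (smooth_cst 0) (smooth_cst 0)).
  by apply/funext => p; rewrite big_nil mulr0.
rewrite (_ : (fun p => _) = fun p => F i p + \sum_(j <- r) F j p).
  exact: separated_add.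
by apply/funext => p; rewrite big_cons.
Qed.

End SeparatedSums.

(** * End points and continuity of word braids *)

Section WordBraids.
Context {R : realType} {n : nat}.
Implicit Types (c : 'I_n -> R * R) (l : 'I_n.-1 * bool) (w : braid_word n).

(** The strand starting at [c i] ends at [c (word_perm w i)]; products of permutations act from left
    to right, in the order of time. *)
Definition word_perm w : {perm 'I_n} := (\prod_(l <- w) exchange l.1)%g.

Lemma word_perm_cons l w i : word_perm (l :: w) i = word_perm w (exchange l.1 i).
Proof. by rewrite /word_perm big_cons permM. Qed.

Lemma half_turn0 c l i : half_turn c l i 0 = c i.
Proof.
rewrite /half_turn /rotate_about mulr0 oppr0 if_same cos0 sin0 !mul1r !mul0r.
by rewrite subr0 add0r [c i]surjective_pairing !subrKC.
Qed.

Lemma half_turn1 c l i : half_turn c l i 1 = c (exchange l.1 i).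
Proof.
rewrite /half_turn /rotate_about mulr1 (fun_if cos) (fun_if sin) cosN sinN cospi sinpi.
rewrite oppr0 !if_same /midpoint [RHS]surjective_pairing.
by congr (_, _) => /=; field.
Qed.

Lemma word_braid0 c w i : word_braid c w i 0 = c i.
Proof. by case: w => [//|l w] /=; rewrite ifT ?mulr0 ?half_turn0. Qed.

Lemma word_braid1 c w i : word_braid c w i 1 = c (word_perm w i).
Proof.
elim: w i => [|l w IH] i /=; first by rewrite /word_perm big_nil perm1.
rewrite ifF ?word_perm_cons -?IH; last by lra.
by congr (word_braid _ _ _ _); ring.
Qed.

Lemma continuous_pair (f g : R -> R) :
  continuous f -> continuous g -> continuous (fun t => (f t, g t)).
Proof. by move=> cf cg t; apply: (cvg_pair (cf t) (cg t)). Qed.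

Lemma continuous_half_turn c l i : continuous (half_turn c l i).
Proof.
have ct : continuous (fun t : R => if l.2 then - (pi * t) else pi * t).
  case: (l.2) => t; [apply: cvgN|]; apply: cvgMl_tmp; exact: cvg_id.
have cc : continuous (fun t : R => cos (if l.2 then - (pi * t) else pi * t)).
  by move=> t; exact: (continuous_comp (ct t) (@continuous_cos R _)).
have cs : continuous (fun t : R => sin (if l.2 then - (pi * t) else pi * t)).
  by move=> t; exact: (continuous_comp (ct t) (@continuous_sin R _)).
have cM (f : R -> R) a : continuous f -> continuous (fun t => f t * a).
  by move=> cf t; apply: cvgM; [exact: cf|exact: cvg_cst].
rewrite /half_turn /rotate_about; apply: continuous_pair => /= t.
  by apply: cvgD; [exact: cvg_cst|apply: cvgB; exact: cM].
by apply: cvgD; [exact: cvg_cst|apply: cvgD; exact: cM].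
Qed.

(** The case distinction is removed: [lo t] is the minimum of [2 * t] and [1], [hi t] is the maximum
    of [2 * t - 1] and [0], and the piece at rest contributes the common value [f 1 = g 0], which is
    subtracted. *)
Lemma continuous_concat (f g : R -> R * R) : continuous f -> continuous g ->
  f 1 = g 0 ->
  continuous (fun t : R => if t <= 2^-1 then f (2 * t) else g (2 * t - 1)).
Proof.
move=> cf cg fg.
pose lo t : R := 2^-1 * (2 * t + 1 - `|2 * t - 1|).
pose hi t : R := 2^-1 * (2 * t - 1 + `|2 * t - 1|).
have -> : (fun t : R => if t <= 2^-1 then f (2 * t) else g (2 * t - 1)) =
    fun t => f (lo t) + g (hi t) - g 0.
  apply/funext => t; rewrite /lo /hi; case: ifPn => [th|]; last rewrite -ltNge => th.
    rewrite ler0_norm; last by lra.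
    by rewrite subrr mulr0 addrK; congr (f _); field.
  rewrite gtr0_norm; last by lra.
  have -> : 2^-1 * (2 * t + 1 - (2 * t - 1)) = 1 by field.
  by rewrite fg addrAC subrr add0r; congr (g _); field.
have c2 : continuous (fun t : R => 2 * t) by move=> t; apply: cvgMl_tmp; exact: cvg_id.
have cn : continuous (fun t : R => `|2 * t - 1|).
  by move=> t; apply: cvg_norm; apply: cvgB; [exact: c2|exact: cvg_cst].
have clo : continuous lo.
  move=> t; apply: cvgMl_tmp; apply: cvgB; last exact: cn.
  by apply: cvgD; [exact: c2|exact: cvg_cst].
have chi : continuous hi.
  move=> t; apply: cvgMl_tmp; apply: cvgD; last exact: cn.
  by apply: cvgB; [exact: c2|exact: cvg_cst].
move=> t; apply: cvgB; last exact: cvg_cst.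
apply: cvgD; first exact: (continuous_comp (clo t) (cf _)).
exact: (continuous_comp (chi t) (cg _)).
Qed.

Lemma continuous_word_braid c w i : continuous (word_braid c w i).
Proof.
elim: w i => [|l w IH] i /=; first by move=> t; exact: cvg_cst.
apply: continuous_concat => //; first exact: continuous_half_turn.
by rewrite half_turn1 word_braid0.
Qed.

End WordBraids.

(** * Shear trajectories realizing a braid word *)

Section ShearFlows.
Context {R : realType} {n : nat}.
Implicit Types (a b ym eta t : R) (x : 'I_n -> R) (dE : 'I_n -> R -> R).
Implicit Types (B : R -> R) (f X Y : 'I_n -> R -> R).

Definition base_points x ym (i : 'I_n) : R * R := (x i, ym).

(** These are the Hamiltonian equations of [\sum_j f j t * E j x + B t * (y - ym) ^+ 2 / 2], with
    [dE j] standing for the derivative of [E j] and the time switches not yet periodized. They hold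
    at all real times, which allows rescaling and concatenation. *)
Record shear_flow a b ym x dE f B X Y (s : {perm 'I_n}) : Prop := ShearFlow {
  shear_f : forall j, smooth (f j) /\ supported (f j);
  shear_B : smooth B /\ supported B;
  shear_X : forall i (t : R), is_derive t 1 (X i) (B t * (Y i t - ym));
  shear_Y : forall i (t : R), is_derive t 1 (Y i) (- \sum_j f j t * dE j (X i t));
  shear_start : forall i (t : R), t <= 0 -> X i t = x i /\ Y i t = ym;
  shear_end : forall i (t : R), 1 <= t -> X i t = x (s i) /\ Y i t = ym;
  shear_strip : forall i (t : R), a <= Y i t <= b }.

(** With this condition the straight-line homotopy from [p] to the shear trajectories passes through
    braids only. *)
Definition disjoint_lines (p : 'I_n -> R -> R * R) X Y := forall s t : R,
  0 <= s <= 1 -> 0 <= t <= 1 -> injective (fun i =>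
    (1 - s) *: p i t + s *: ((X i t, Y i t) : R * R)).

Lemma supported_cst0 : supported (fun=> 0 : R).
Proof. by exists 1. Qed.

Lemma shear_nil a b ym x dE : a <= ym <= b -> injective x -> exists f B X Y,
  shear_flow a b ym x dE f B X Y (word_perm [::]) /\
  disjoint_lines (word_braid (base_points x ym) [::]) X Y.
Proof.
move=> ymab x_inj.
exists (fun _ _ => 0), (fun=> 0), (fun i _ => x i), (fun _ _ => ym); split.
  have s0 : smooth (fun=> 0 : R) /\ supported (fun=> 0 : R).
    by split; [exact: smooth_cst|exact: supported_cst0].
  split=> //.
  - by move=> i t; rewrite mul0r; exact: is_derive_cst.
  - move=> i t; rewrite big1 ?oppr0; first exact: is_derive_cst.
    by move=> j _; rewrite mul0r.
  - by move=> i t _; rewrite /word_perm big_nil perm1.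
move=> s t _ _ i j /= /(congr1 fst) /=.
by rewrite -!scalerDl !subrK !scale1r => /x_inj.
Qed.

Lemma smooth_rescale (f : R -> R) p q : smooth f -> smooth (fun t => 2 * f (p * t + q)).
Proof.
move=> sf; apply: smooth_mul; first exact: smooth_cst.
exact: smooth_comp sf (smooth_affine _ _).
Qed.

Lemma supported_concat (f g : R -> R) : supported f -> supported g ->
  supported (fun t => 2 * f (2 * t + 0) + 2 * g (2 * t + -1)).
Proof.
move=> sf sg; have [d d0 fd] := sf; have [e e0 ge] := sg.
(* Margins are halved by the rescaling of time; the bound [2^-1] ensures that the other piece
   vanishes. *)
exists (Num.min (Num.min (d / 2) (e / 2)) 2^-1).
  by rewrite !lt_min !divr_gt0// invr_gt0 ltr0n.
move=> t; rewrite ltrBlDr -ltrBlDl !lt_min.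
case=> [/andP[/andP[td te] th]|/andP[/andP[td te] th]].
  by rewrite fd ?(supported_le0 sg) ?mulr0 ?addr0//; [lra|left; lra].
by rewrite ge ?(supported_ge1 sf) ?mulr0 ?addr0//; [lra|right; lra].
Qed.

Lemma is_derive_rescale (f : R -> R) (t q d : R) : is_derive (2 * t + q) 1 f d ->
  is_derive t 1 (fun u => f (2 * u + q)) (2 * d).
Proof.
move=> fd; rewrite mulrC.
by apply: (@is_derive_compf _ f (fun u => 2 * u + q)); last exact: is_derive_affine.
Qed.

(* Strands rest outside [0, 1], so concatenation in time is a plain sum of
   rescaled trajectories. *)
Lemma shear_cons a b ym x dE l w fl Bl Xl Yl fw Bw Xw Yw :
  shear_flow a b ym x dE fl Bl Xl Yl (exchange l.1) ->
  disjoint_lines (half_turn (base_points x ym) l) Xl Yl ->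
  shear_flow a b ym x dE fw Bw Xw Yw (word_perm w) ->
  disjoint_lines (word_braid (base_points x ym) w) Xw Yw ->
  exists f B X Y, shear_flow a b ym x dE f B X Y (word_perm (l :: w)) /\
                  disjoint_lines (word_braid (base_points x ym) (l :: w)) X Y.
Proof.
move=> sl dl sw dw; set e := exchange l.1.
pose f j t := 2 * fl j (2 * t + 0) + 2 * fw j (2 * t + -1).
pose B t := 2 * Bl (2 * t + 0) + 2 * Bw (2 * t + -1).
(* Strand [i] continues as strand [e i] of the second piece. Whichever piece is at rest contributes
   the junction point, which is subtracted. *)
pose X i t := Xl i (2 * t + 0) + Xw (e i) (2 * t + -1) - x (e i).
pose Y i t := Yl i (2 * t + 0) + Yw (e i) (2 * t + -1) - ym.
have first_half i t : 2 * t + -1 <= 0 ->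
    X i t = Xl i (2 * t + 0) /\ Y i t = Yl i (2 * t + 0).
  by move=> /(shear_start sw (e i))[]; rewrite /X /Y => -> ->; rewrite !addrK.
have second_half i t : 1 <= 2 * t + 0 ->
    X i t = Xw (e i) (2 * t + -1) /\ Y i t = Yw (e i) (2 * t + -1).
  move=> /(shear_end sl i)[]; rewrite /X /Y => -> ->.
  by rewrite ![_ + _ - _]addrAC !subrr !add0r.
have half t : 2 * t + -1 <= 0 \/ 1 <= 2 * t + 0.
  by case: (leP (2 * t + -1) 0) => th; [left|right; lra].
exists f, B, X, Y; split.
  split.
  - move=> j; have [? ?] := shear_f sl j; have [? ?] := shear_f sw j.
    by split; [apply: smooth_add; exact: smooth_rescale|exact: supported_concat].
  - have [? ?] := shear_B sl; have [? ?] := shear_B sw.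
    by split; [apply: smooth_add; exact: smooth_rescale|exact: supported_concat].
  - move=> i t; rewrite -[X in is_derive _ _ _ X](_ :
      2 * (Bl (2 * t + 0) * (Yl i (2 * t + 0) - ym)) +
      2 * (Bw (2 * t + -1) * (Yw (e i) (2 * t + -1) - ym)) + 0 = _).
      apply: is_derive_addf; apply: is_derive_addf; apply: is_derive_rescale.
        exact: shear_X sl _ _.
      exact: shear_X sw _ _.
    rewrite /B; have [th|th] := half t.
      rewrite (first_half i t th).2 (supported_le0 (shear_B sw).2 th); ring.
    rewrite (second_half i t th).2 (supported_ge1 (shear_B sl).2 th); ring.
  - move=> i t; rewrite -[X in is_derive _ _ _ X](_ :
      2 * (- \sum_j fl j (2 * t + 0) * dE j (Xl i (2 * t + 0))) +
      2 * (- \sum_j fw j (2 * t + -1) * dE j (Xw (e i) (2 * t + -1))) + 0 = _).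
      apply: is_derive_addf; apply: is_derive_addf; apply: is_derive_rescale.
        exact: shear_Y sl _ _.
      exact: shear_Y sw _ _.
    rewrite addr0 !mulrN -opprD !mulr_sumr -big_split /=; congr (- _).
    apply: eq_bigr => j _; rewrite /f; have [th|th] := half t.
      rewrite (first_half i t th).1 (supported_le0 (shear_f sw j).2 th); ring.
    rewrite (second_half i t th).1 (supported_ge1 (shear_f sl j).2 th); ring.
  - move=> i t t0; rewrite (first_half i t _).1 ?(first_half i t _).2; [|lra|lra].
    by apply: (shear_start sl); lra.
  - move=> i t t0; rewrite (second_half i t _).1 ?(second_half i t _).2; [|lra|lra].
    by rewrite word_perm_cons; apply: (shear_end sw); lra.
  - move=> i t; have [th|th] := half t.
      by rewrite (first_half i t th).2; exact: shear_strip sl _ _.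
    by rewrite (second_half i t th).2; exact: shear_strip sw _ _.
move=> s t hs ht; rewrite /=; case: (leP t 2^-1) => th.
  have t1 : 0 <= 2 * t <= 1 by lra.
  move=> i j; have th' : 2 * t + -1 <= 0 by lra.
  rewrite !(first_half _ _ th').1 !(first_half _ _ th').2 addr0.
  exact: (dl s (2 * t) hs t1).
have t1 : 0 <= 2 * t - 1 <= 1 by lra.
move=> i j; have th' : 1 <= 2 * t + 0 by lra.
rewrite !(second_half _ _ th').1 !(second_half _ _ th').2.
by move=> /(dw s (2 * t - 1) hs t1)/perm_inj.
Qed.

(* The k-th phase is active for 5 * t between k + 1 and k + 2. *)
Definition phase (k : nat) (t : R) : R := step (5 * t + - k.+1%:R).

(** Strand [i] is displaced vertically by [eps * eta * D i], where [D i] is the horizontal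
    displacement it needs. The horizontal shear moves it in proportion to its height, by exactly
    [D i], and the last phase restores the height. Strands that are not exchanged have [D i = 0] and
    never move. *)
Lemma shear_letter a b ym eta x dE l :
  0 < eta -> a <= ym - eta -> ym + eta <= b -> injective x ->
  (forall i j, `|x i - x j| <= 1) -> (forall j k, dE j (x k) = (j == k)%:R) ->
  exists f B X Y,
  shear_flow a b ym x dE f B X Y (exchange l.1) /\
  disjoint_lines (half_turn (base_points x ym) l) X Y.
Proof.
move=> eta0 ha hb x_inj x01 dE_x; set e := exchange l.1.
have eK i : e (e i) = i by exact: tpermK.
pose D i := x (e i) - x i.
(* In a clockwise half-turn the strand moving right passes above, hence [1] for positive letters. *)
pose eps : R := if l.2 then 1 else -1.
have eps2 : eps * eps = 1 by rewrite /eps; case: (l.2); ring.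
have eps_norm : `|eps| = 1 by rewrite /eps; case: (l.2); rewrite ?normrN normr1.
have [dstep dstepP sdstep] := smoothE (@smooth_step R).
have dstep0 (u : R) : u < 0 \/ 1 < u -> dstep u = 0.
  move=> hu; apply: (is_derive_unique (dstepP u)).
  case: hu => hu.
    apply: (@is_derive_near_cst _ _ _ 0); near=> v; apply/step_le0/ltW.
    by near: v; exact: lt_nbhsl.
  apply: (@is_derive_near_cst _ _ _ 1); near=> v; apply/step_ge1/ltW.
  by near: v; exact: lt_nbhsr.
pose dphase (k : nat) (t : R) : R := 5 * dstep (5 * t + - k.+1%:R).
have phaseP k (t : R) : is_derive t 1 (phase k) (dphase k t).
  rewrite /dphase mulrC.
  apply: (@is_derive_compf _ step (fun u => 5 * u + - k.+1%:R)) => //.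
  exact: is_derive_affine.
have sphase k : smooth (dphase k).
  apply: smooth_mul; first exact: smooth_cst.
  exact: smooth_comp sdstep (smooth_affine _ _).
have dphase0 k t : 5 * t < k.+1%:R \/ k.+2%:R < 5 * t -> dphase k t = 0.
  move=> ht; rewrite /dphase dstep0 ?mulr0//.
  by case: ht => ht; [left|right]; rewrite -?natr1 in ht *; lra.
have phase0 k t : 5 * t <= k.+1%:R -> phase k t = 0.
  by move=> ht; apply: step_le0; rewrite subr_le0.
have phase1 k t : k.+2%:R <= 5 * t -> phase k t = 1.
  by move=> ht; apply: step_ge1; rewrite -natr1 in ht; lra.
have phase_ge0 k t : 0 <= phase k t by exact: step_ge0.
have phase_le1 k t : phase k t <= 1 by exact: step_le1.
(* In the last phase strand [i] has abscissa [x (e i)], and [D (e i) = - D i]: the same coefficient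
   then undoes the lift. *)
pose f j t := - (eps * eta * D j) * (dphase 0%N t + dphase 2%N t).
(* The factor [eps / eta] turns the height [eps * eta * D i] into the displacement [D i], since
   [eps * eps = 1]. *)
pose B t := eps / eta * dphase 1%N t.
pose X i t := x i + D i * phase 1%N t.
pose Y i t := ym + eps * eta * D i * (phase 0%N t - phase 2%N t).
have lift_ge0 t : 0 <= phase 0%N t - phase 2%N t <= 1.
  rewrite lerBlDr (le_trans (phase_le1 _ _)) ?lerDl// andbT subr_ge0.
  case: (leP (5 * t) 3) => ht; first by rewrite (phase0 2%N).
  by rewrite (phase1 0%N)// ltW// (lt_trans _ ht)// ltr_nat.
exists f, B, X, Y; split.
  split.
  - move=> j; split.
      apply: smooth_mul; first exact: smooth_cst.
      exact: smooth_add.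
    (* All three phases take place between the times [1 / 5] and [4 / 5]. *)
    exists (1 / 5); first by rewrite divr_gt0.
    by move=> t ht; rewrite /f !dphase0 ?addr0 ?mulr0//;
      case: ht => ht; [left|right|left|right]; lra.
  - split; first by apply: smooth_mul; first exact: smooth_cst.
    exists (1 / 5); first by rewrite divr_gt0.
    by move=> t ht; rewrite /B dphase0 ?mulr0//; case: ht => ht; [left|right]; lra.
  - move=> i t; rewrite -[X in is_derive _ _ _ X](_ :
      0 + (0 * phase 1%N t + D i * dphase 1%N t) = _).
      by apply: is_derive_addf; apply: is_derive_mulf.
    rewrite /B /Y; case: (ltP (5 * t) 2) => h1.
      by rewrite dphase0; [ring|left].
    case: (ltP 3 (5 * t)) => h2; first by rewrite dphase0; [ring|right].
    rewrite (phase1 0%N)// (phase0 2%N)//.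
    rewrite [RHS](_ : _ = eps * eps * (eta / eta) * D i * dphase 1%N t); last by ring.
    by rewrite eps2 divff ?gt_eqF//; ring.
  - move=> i t; rewrite -[X in is_derive _ _ _ X](_ :
      0 + (0 * (phase 0%N t - phase 2%N t) +
           eps * eta * D i * (dphase 0%N t - dphase 2%N t)) = _).
      by apply: is_derive_addf; apply: is_derive_mulf.
    have sumE k : \sum_j f j t * (j == k)%:R = f k t.
      rewrite (bigD1 k)//= eqxx mulr1 big1 ?addr0// => j /negPf ->.
      by rewrite mulr0.
    have DeE : D (e i) = - D i by rewrite /D eK opprB.
    (* Before and after the middle phase the abscissa is a node, where the slopes [dE] are
       prescribed; during it the vertical switches are off. *)
    case: (leP (5 * t) 2) => h1.
      rewrite /X (phase0 1%N) ?mulr0 ?addr0//.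
      under eq_bigr do rewrite dE_x.
      by rewrite sumE /f (dphase0 2%N); [ring|left; lra].
    case: (leP 3 (5 * t)) => h2.
      have -> : X i t = x (e i) by rewrite /X (phase1 1%N) ?mulr1// /D addrC subrK.
      under eq_bigr do rewrite dE_x.
      by rewrite sumE /f DeE (dphase0 0%N) /D; [ring|right; lra].
    rewrite big1 ?oppr0; last first.
      by move=> j _; rewrite /f !dphase0 ?addr0 ?mulr0 ?mul0r//; [left|right].
    by rewrite !dphase0; [ring|left|right].
  - by move=> i t t0; rewrite /X /Y !phase0 ?mulr0 ?subr0 ?mulr0 ?addr0//; lra.
  - move=> i t t1; rewrite /X /Y !phase1 ?subrr ?mulr0 ?mulr1 ?addr0; try lra.
    by rewrite /D addrC subrK.
  - move=> i t; have hD : `|eps * eta * D i * (phase 0%N t - phase 2%N t)| <= eta.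
      have /andP[l0 l1] := lift_ge0 t.
      rewrite !normrM eps_norm mul1r (gtr0_norm eta0) (ger0_norm l0).
      by rewrite -mulrA ler_piMr ?(ltW eta0)// mulr_ile1 ?x01.
    move: hD; rewrite ler_norml /Y => /andP[h1 h2]; apply/andP; split; lra.
move=> s t /andP[s0 s1] /andP[t0 t1] i j.
(* Half-turn and shear both displace strand [k] by [D k] times coefficients common to all strands;
   [g] and [eps * h] interpolate between them. *)
pose g : R := (1 - s) * ((1 - cos (pi * t)) / 2) + s * phase 1%N t.
pose h : R := (1 - s) * (sin (pi * t) / 2) + s * (eta * (phase 0%N t - phase 2%N t)).
have lineE k : (1 - s) *: half_turn (base_points x ym) l k t +
    s *: ((X k t, Y k t) : R * R) =
    (x k + g * D k, ym + eps * h * D k).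
  transitivity ((1 - s) * (half_turn (base_points x ym) l k t).1 + s * X k t,
    (1 - s) * (half_turn (base_points x ym) l k t).2 + s * Y k t) => //.
  rewrite /half_turn /rotate_about /midpoint /base_points /= -/e.
  have -> : cos (if l.2 then - (pi * t) else pi * t) = cos (pi * t).
    by case: (l.2); rewrite ?cosN.
  have -> : sin (if l.2 then - (pi * t) else pi * t) = - eps * sin (pi * t).
    by rewrite /eps; case: (l.2); rewrite ?sinN; ring.
  by congr (_, _); rewrite /X /Y /g /h /D /=; field.
rewrite !lineE => -[gij hij].
have pit : 0 <= pi * t <= pi.
  by rewrite mulr_ge0 ?pi_ge0//= ger_pMr ?pi_gt0.
have sin0' : 0 <= sin (pi * t) by exact: sin_ge0_pi.
have /andP[lift0 _] := lift_ge0 t.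
have h1 : 0 <= (1 - s) * (sin (pi * t) / 2) by rewrite !mulr_ge0 ?invr_ge0// subr_ge0.
have h2 : 0 <= s * (eta * (phase 0%N t - phase 2%N t)) by rewrite !mulr_ge0// ltW.
(* If h > 0, equal heights force D i = D j, hence x i = x j; if h = 0, then
   all strands are at their initial or at their final positions. *)
have [h0|h0] := eqVneq h 0; last first.
  have Dij : D i = D j.
    have eh : eps * h != 0 by rewrite mulf_neq0// -normr_eq0 eps_norm oner_neq0.
    by move/addrI: hij => /(mulfI eh).
  by apply: x_inj; move: gij; rewrite Dij => /addIr.
have g01 : g = 0 \/ g = 1.
  have : h == 0 by rewrite h0.
  rewrite /h paddr_eq0// !mulf_eq0 (gt_eqF eta0) invr_eq0 pnatr_eq0 !orbF /=.
  case: (eqVneq (sin (pi * t)) 0) => [sin0 _|sinN0].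
    have : ~~ (0 < t < 1).
      apply/negP => /andP[t0' t1']; have := @sin_gt0_pi R (pi * t).
      by rewrite sin0 ltxx mulr_gt0 ?pi_gt0// gtr_pMr ?pi_gt0//= t1' => /(_ isT).
    rewrite lt_neqAle t0 andbT lt_neqAle t1 andbT negb_and !negbK.
    case/orP => /eqP tE; rewrite /g.
      by left; rewrite -tE mulr0 cos0 subrr mul0r phase0 ?mulr0 ?addr0//; lra.
    by right; rewrite tE mulr1 cospi phase1; [field|lra].
  (* Here [s = 1], so only the shear remains; its lift vanishes, which excludes the time window of
     the horizontal phase, where the lift equals [1]. *)
  rewrite orbF subr_eq0 => /andP[/eqP s1'].
  rewrite /g -s1' oner_eq0/= subrr !mul0r add0r mul1r => lift.
  case: (leP (5 * t) 2) => ht; first by left; exact: phase0.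
  case: (leP 3 (5 * t)) => ht'; first by right; exact: phase1.
  have : phase 0%N t - phase 2%N t = 1.
    by rewrite phase1 ?phase0 ?subr0// ltW.
  by move/eqP: lift => ->; move/eqP; rewrite eq_sym oner_eq0.
case: g01 gij => ->; first by rewrite !mul0r !addr0 => /x_inj.
by rewrite !mul1r /D !subrKC => /x_inj/perm_inj.
Unshelve. all: by end_near. Qed.

End ShearFlows.

(** * The periodic Hamiltonian, its trajectories and their braid class *)

Section Assembly.
Context {R : realType} {n : nat}.
Implicit Types (a b ym eta t : R) (x : 'I_n -> R) (E dE : 'I_n -> R -> R).
Implicit Types (B : R -> R) (f X Y : 'I_n -> R -> R).

Lemma shear_word a b ym eta x dE w :
  0 < eta -> a <= ym - eta -> ym + eta <= b -> injective x ->
  (forall i j, `|x i - x j| <= 1) -> (forall j k, dE j (x k) = (j == k)%:R) ->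
  exists f B X Y, shear_flow a b ym x dE f B X Y (word_perm w) /\
    disjoint_lines (word_braid (base_points x ym) w) X Y.
Proof.
move=> eta0 ha hb x_inj x01 dE_x; elim: w => [|l w IH].
  by apply: shear_nil => //; apply/andP; split; lra.
have [fl [Bl [Xl [Yl [? ?]]]]] := shear_letter l eta0 ha hb x_inj x01 dE_x.
have [fw [Bw [Xw [Yw [? ?]]]]] := IH.
exact: (@shear_cons _ _ _ _ _ _ _ l w fl Bl Xl Yl fw Bw Xw Yw).
Qed.

(** The sum generates the vertical shears, the quadratic term the horizontal one. *)
Definition shear_hamiltonian ym E f B (p : R * R * R) : R :=
  \sum_j periodize (f j) p.1.1 * E j p.1.2 +
  periodize B p.1.1 * ((p.2 - ym) ^+ 2 / 2).

Lemma shear_hamiltonian_annulus a b ym x E dE f B X Y s :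
  shear_flow a b ym x dE f B X Y s ->
  (forall j, smooth (E j)) -> (forall j u, E j (u + 1) = E j u) ->
  annulus_hamiltonian a b (shear_hamiltonian ym E f B).
Proof.
move=> sf sE pE; split.
  apply: separated_smooth.
  have s1 : smooth (fun=> 1 : R) by exact: smooth_cst.
  (* The halved square is written as a product of two affine functions. *)
  have sq : smooth (fun y : R => (1 * y + - ym) * (2^-1 * y + - (ym / 2))).
    by apply: smooth_mul; exact: smooth_affine.
  have -> : shear_hamiltonian ym E f B = fun p =>
      (\sum_j periodize (f j) p.1.1 * E j p.1.2 * (fun=> 1) p.2) +
      periodize B p.1.1 * (fun=> 1) p.1.2 *
        (fun y : R => (1 * y + - ym) * (2^-1 * y + - (ym / 2))) p.2.
    apply/funext => p; rewrite /shear_hamiltonian; congr (_ + _).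
      by apply: eq_bigr => j _; rewrite mulr1.
    by rewrite mulr1; field.
  apply: separated_add; first apply: separated_sum => j.
    have [smf spf] := shear_f sf j.
    exact: (separated_mul (smooth_periodize smf spf) (sE j) s1).
  have [smB spB] := shear_B sf.
  exact: (separated_mul (smooth_periodize smB spB) s1 sq).
move=> t u y _; rewrite /shear_hamiltonian /= !periodize_period; split.
  by congr (_ + _); apply: eq_bigr => j _; rewrite periodize_period.
by congr (_ + _); apply: eq_bigr => j _; rewrite pE.
Qed.

Lemma shear_hamiltonian_y ym E f B (t u y : R) :
  'D_(dir_y R) (shear_hamiltonian ym E f B) (t, u, y) = periodize B t * (y - ym).
Proof.
apply: derive_val; apply: is_derive_line.
have -> : (fun s : R => shear_hamiltonian ym E f B (s *: dir_y R + (t, u, y))) =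
   fun s => \sum_j periodize (f j) t * E j u +
     periodize B t * ((1 * s + (y - ym)) * (2^-1 * s + (y - ym) / 2)).
  apply/funext => s; rewrite /shear_hamiltonian /=.
  rewrite ![s *: 0]mulr0 [s *: 1]mulr1 !add0r.
  by congr (_ + _ * _); field.
have aff := fun c d : R => is_derive_affine 0 c d.
have := is_derive_addf (is_derive_cst (\sum_j periodize (f j) t * E j u) (0 : R) 1)
  (is_derive_mulf (is_derive_cst (periodize B t) (0 : R) 1)
     (is_derive_mulf (aff 1 (y - ym)) (aff 2^-1 ((y - ym) / 2)))).
congr (is_derive _ _ _ _).
by rewrite /cst; field.
Qed.

Lemma shear_hamiltonian_x ym E dE f B (t u y : R) :
  (forall j (z : R), is_derive z 1 (E j) (dE j z)) ->
  'D_(dir_x R) (shear_hamiltonian ym E f B) (t, u, y) =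
  \sum_j periodize (f j) t * dE j u.
Proof.
move=> EP; apply: derive_val; apply: is_derive_line.
have -> : (fun s : R => shear_hamiltonian ym E f B (s *: dir_x R + (t, u, y))) =
   fun s => \sum_j periodize (f j) t * E j (1 * s + u) +
     periodize B t * ((y - ym) ^+ 2 / 2).
  apply/funext => s; rewrite /shear_hamiltonian /=.
  by rewrite ![s *: 0]mulr0 [s *: 1]mulr1 !add0r mul1r.
rewrite -[X in is_derive _ _ _ X]addr0.
apply: is_derive_addf.
apply: is_derive_sumf => j.
have Ej : is_derive (0 : R) 1 (fun s => E j (1 * s + u)) (dE j u * 1).
  apply: (@is_derive_compf _ (E j) (fun s => 1 * s + u)); last exact: is_derive_affine.
  by rewrite mulr0 add0r.
have := is_derive_mulf (is_derive_cst (periodize (f j) t) (0 : R) 1) Ej.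
by rewrite mul0r add0r mulr1.
Qed.

Lemma shear_flow_trajectory a b ym x E dE f B X Y s i :
  shear_flow a b ym x dE f B X Y s ->
  (forall j (z : R), is_derive z 1 (E j) (dE j z)) ->
  flow_trajectory a b (shear_hamiltonian ym E f B) (base_points x ym i)
    (fun t => (X i t, Y i t)).
Proof.
move=> sf EP; split.
- by have [-> ->] := shear_start sf i (lexx 0).
- by move=> t _; exact: shear_strip sf i t.
- apply: continuous_subspaceT; apply: continuous_pair.
    exact: is_derive_continuous (shear_X sf i).
  exact: is_derive_continuous (shear_Y sf i).
move=> t; rewrite in_itv /= => t01.
(* At interior times the periodized switches coincide with the original ones. *)
rewrite shear_hamiltonian_y (shear_hamiltonian_x _ _ _ _ _ _ EP) !periodize_id//.
split; first exact: shear_X sf i t.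
under eq_bigr do rewrite periodize_id//.
exact: shear_Y sf i t.
Qed.

(** Word braid and shear trajectories share their end points, so every stage of the straight-line
    homotopy does too, and [disjoint_lines] excludes collisions. *)
Lemma shear_flow_represents a b ym x dE f B X Y w :
  (forall i j : 'I_n, (i < j)%N -> x i < x j) -> injective x ->
  shear_flow a b ym x dE f B X Y (word_perm w) ->
  disjoint_lines (word_braid (base_points x ym) w) X Y ->
  represents (fun i t => (X i t, Y i t)) (word_eval w).
Proof.
move=> x_lt x_inj sf dl.
pose c := base_points x ym.
pose phi i t := (X i t, Y i t).
pose F (s : R) i t := (1 - s) *: word_braid c w i t + s *: (phi i t : R * R).
have phi0 i : phi i 0 = c i by rewrite /phi; have [-> ->] := shear_start sf i (lexx 0).
have phi1 i : phi i 1 = c (word_perm w i).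
  by rewrite /phi; have [-> ->] := shear_end sf i (lexx 1).
have combine s (z : R * R) : (1 - s) *: z + s *: z = z.
  by rewrite -scalerDl subrK scale1r.
have F0 s i : F s i 0 = c i by rewrite /F phi0 word_braid0 combine.
have F1 s i : F s i 1 = c (word_perm w i) by rewrite /F phi1 word_braid1 combine.
have cphi i : continuous (phi i).
  apply: continuous_pair; first exact: is_derive_continuous (shear_X sf i).
  exact: is_derive_continuous (shear_Y sf i).
have cF i : continuous (fun st : R * R => F st.1 i st.2).
  move=> [s t]; apply: cvgD; apply: cvgZ.
  - by apply: cvgB; [exact: cvg_cst|exact: cvg_fst].
  - by apply: (continuous_comp (f := snd)); [exact: cvg_snd|exact: continuous_word_braid].
  - exact: cvg_fst.
  - by apply: (continuous_comp (f := snd)); [exact: cvg_snd|exact: cphi].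
have gF s : s \in `[0, 1] -> geometric_braid (F s).
  rewrite in_itv /= => s01; split.
  - move=> i; apply: continuous_subspaceT => t.
    by apply: cvgD; apply: cvgZ; try exact: cvg_cst;
      [exact: continuous_word_braid|exact: cphi].
  - by move=> t; rewrite in_itv /= => t01; exact: dl.
  - rewrite (_ : (fun i => F s i 1) = c \o word_perm w);
      last by apply/funext => i; rewrite F1.
    rewrite (_ : (fun i => F s i 0) = c); last by apply/funext => i; rewrite F0.
    apply/seteqP; split=> [_ [i _ <-]|_ [i _ <-]]; first by exists (word_perm w i).
    by exists ((word_perm w)^-1%g i) => //=; rewrite permKV.
  - split=> [i j|i j ij]; rewrite !F0 //=.
    exact: x_lt.
have FE1 : F 1 = phi.
  by apply/funext => i; apply/funext => t; rewrite /F subrr scale0r add0r scale1r.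
split.
  by rewrite -[X in geometric_braid X]FE1; apply: gF; rewrite in_itv /= ler01 lexx.
exists w => //; exists F; split=> //.
- by move=> i; apply: continuous_subspaceT; exact: cF.
- by move=> s i _; rewrite F0 word_braid0 -phi0.
move=> i t _; split; last exact: (congr1 (fun G => G i t) FE1).
rewrite /F subr0 scale1r scale0r addr0.
by congr (word_braid _ _ _ _); apply/funext => j; rewrite -phi0.
Qed.

End Assembly.

Unset Implicit Arguments.
Set Strict Implicit.

Theorem theorem1p3 (R : realType) (a b : R) (hab : a < b) (n : nat)
    (hn : (1 <= n)%N) (beta : braid_group n) :
  exists (H : R * R * R -> R) (c : 'I_n -> R * R),
    [/\ annulus_hamiltonian a b H,
        forall i, strip a b (c i)
      & exists phi : 'I_n -> R -> R * R,
          (forall i, flow_trajectory a b H (c i) (phi i)) /\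
          represents phi beta].
Proof.
have [w <-] : exists w, word_eval w = beta.
  by eexists; rewrite word_evalE; exact: braid_class_repr.
(* Equally spaced nodes in [[0, 1[]: distinct modulo [1], as the interpolation requires. *)
pose x (i : 'I_n) : R := i%:R / n%:R.
have n0 : 0 < n%:R :> R by rewrite ltr0n.
have x_lt (i j : 'I_n) : (i < j)%N -> x i < x j.
  by move=> ij; rewrite ltr_pM2r ?invr_gt0// ltr_nat.
have x_inj : injective x.
  move=> i j /(mulIf (invr_neq0 (lt0r_neq0 n0)))/eqP; rewrite eqr_nat.
  by move/eqP/val_inj.
have x_ge0 i : 0 <= x i by rewrite divr_ge0.
have x_lt1 i : x i < 1 by rewrite ltr_pdivrMr// mul1r ltr_nat.
have x01 i j : `|x i - x j| < 1.
  have := x_ge0 i; have := x_ge0 j; have := x_lt1 i; have := x_lt1 j.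
  by rewrite ltr_norml => *; apply/andP; split; lra.
have x_apart i j : i != j -> 0 < `|x i - x j| < 1.
  by move=> ij; rewrite x01 andbT normr_gt0 subr_eq0 (inj_eq x_inj).
have [E [dE [sE pE EP dE_x]]] := trig_interpolation x_apart.
(* The base line is the middle of the strip and [eta] its half-width, so the lifts fill at most the
   strip. *)
pose eta := (b - a) / 2; pose ym := (a + b) / 2.
have eta0 : 0 < eta by rewrite divr_gt0// subr_gt0.
have ha : a <= ym - eta by rewrite /ym /eta; lra.
have hb : ym + eta <= b by rewrite /ym /eta; lra.
have [f [B [X [Y [sf dl]]]]] := shear_word w eta0 ha hb x_inj
  (fun i j => ltW (x01 i j)) dE_x.
exists (shear_hamiltonian ym E f B), (base_points x ym); split.
- exact: shear_hamiltonian_annulus sf sE pE.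
- by move=> i; rewrite /strip /=; apply/andP; split; lra.
exists (fun i t => (X i t, Y i t)); split.
  by move=> i; exact: shear_flow_trajectory sf EP.
exact: shear_flow_represents sf dl.
Qed.
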